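(* Let $\{a_n\}_{n\in\mathbb{Z}}\subseteq\mathbb{H}$ and let the quaternionic Laurent series $\sum_{n \in \mathbb{Z}} q^n a_n$ have domain of convergence $A = A(0,R_1,R_2)$ with $R_1 < R_2$. Then the function $f : A \to \mathbb{H}$, $q \mapsto \sum_{n \in \mathbb{Z}} q^n a_n$, is a regular function.
   Context: $\mathbb{H}$ is the skew field of real quaternions, $\mathbb{S} = \{q \in \mathbb{H} : q^2=-1\}$, $L_I = \mathbb{R} + I\mathbb{R}$ for $I\in\mathbb{S}$, $A(0,R_1,R_2)=\{q\in\mathbb{H}:R_1<|q|<R_2\}$ with $0\le R_i\le\infty$. For any $\{a_n\}_{n\in\mathbb{Z}}\subseteq\mathbb{H}$ there exist $R_1,R_2\in[0,\infty]$ such that $\sum_{n\in\mathbb{N}}q^na_n$ and $\sum_{n\in\mathbb{N}}q^{-n}a_{-n}$ both converge absolutely and uniformly on compact subsets of $A=A(0,R_1,R_2)$, while at every $q\in\mathbb{H}\setminus\bar A$ (except possibly $0$ if $A=\emptyset$) at least one of them diverges. When $R_1<R_2$, $A$ is called the domain of convergence of $\sum_{n\in\mathbb{Z}}q^na_n$, and the sum is defined on $A$ as $\sum_{n\ge0}q^na_n+\sum_{n>0}q^{-n}a_{-n}$. For a domain $\Omega\subseteq\mathbb{H}$, a real differentiable $f:\Omega\to\mathbb{H}$ is regular (Cullen-regular) if for every $I\in\mathbb{S}$ the function $\frac12\left(\frac{\partial}{\partial x}+I\frac{\partial}{\partial y}\right)f_I(x+Iy)$ vanishes identically on $\Omega_I=\Omega\cap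 L_I$, where $f_I=f|_{\Omega_I}$. *)

(* Defs.v *)
From HB Require Import structures.
From mathcomp Require Import all_boot all_order all_algebra.
From mathcomp Require Import ring lra.
From mathcomp Require Import boolp classical_sets reals ereal.
From mathcomp Require Import topology normedtype sequences derive.

Set Implicit Arguments.
Unset Strict Implicit.
Unset Printing Implicit Defensive.

Import Order.TTheory GRing.Theory Num.Theory.
Import numFieldTopology.Exports numFieldNormedType.Exports.

Local Open Scope classical_set_scope.
Local Open Scope ring_scope.

(* [Quat a b c d] is a + b i + c j + d k. *)
Record quaternion (R : Type) := Quat { qre : R; qi : R; qj : R; qk : R }.

Section QuaternionAlgebra.
Variable R : realType.
Local Notation H := (quaternion R).

Definition quat_code (q : H) : R * R * R * R := (qre q, qi q, qj q, qk q).
Definition quat_decode (t : R * R * R * R) : H :=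
  let: (a, b, c, d) := t in Quat a b c d.

Lemma quat_codeK : cancel quat_code quat_decode.
Proof. by case. Qed.

HB.instance Definition _ := Choice.copy H (can_type quat_codeK).

Definition quat_add (p q : H) : H :=
  Quat (qre p + qre q) (qi p + qi q) (qj p + qj q) (qk p + qk q).
Definition quat_opp (p : H) : H := Quat (- qre p) (- qi p) (- qj p) (- qk p).

Lemma quat_addA : associative quat_add.
Proof. by case=> ? ? ? ? [? ? ? ?] [? ? ? ?]; congr Quat; rewrite /= addrA. Qed.
Lemma quat_addC : commutative quat_add.
Proof. by case=> ? ? ? ? [? ? ? ?]; congr Quat; rewrite /= addrC. Qed.
Lemma quat_add0 : left_id (Quat 0 0 0 0) quat_add.
Proof. by case=> ? ? ? ?; congr Quat; rewrite /= add0r. Qed.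
Lemma quat_addN : left_inverse (Quat 0 0 0 0) quat_opp quat_add.
Proof. by case=> ? ? ? ?; congr Quat; rewrite /= addNr. Qed.

HB.instance Definition _ :=
  GRing.isZmodule.Build H quat_addA quat_addC quat_add0 quat_addN.

Definition quat_mul (p q : H) : H :=
  Quat (qre p * qre q - qi p * qi q - qj p * qj q - qk p * qk q)
       (qre p * qi q + qi p * qre q + qj p * qk q - qk p * qj q)
       (qre p * qj q - qi p * qk q + qj p * qre q + qk p * qi q)
       (qre p * qk q + qi p * qj q - qj p * qi q + qk p * qre q).

Lemma quat_mulA : associative quat_mul.
Proof. by case=> ? ? ? ? [? ? ? ?] [? ? ? ?]; congr Quat => /=; ring. Qed.
Lemma quat_mul1l : left_id (Quat 1 0 0 0) quat_mul.
Proof. by case=> ? ? ? ?; congr Quat => /=; ring. Qed.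
Lemma quat_mul1r : right_id (Quat 1 0 0 0) quat_mul.
Proof. by case=> ? ? ? ?; congr Quat => /=; ring. Qed.
Lemma quat_mulDl : left_distributive quat_mul +%R.
Proof. by case=> ? ? ? ? [? ? ? ?] [? ? ? ?]; congr Quat => /=; ring. Qed.
Lemma quat_mulDr : right_distributive quat_mul +%R.
Proof. by case=> ? ? ? ? [? ? ? ?] [? ? ? ?]; congr Quat => /=; ring. Qed.
Lemma quat_oner_neq0 : Quat 1 0 0 0 != 0 :> H.
Proof. by apply/eqP => -[/eqP]; rewrite oner_eq0. Qed.

HB.instance Definition _ := GRing.Zmodule_isNzRing.Build H
  quat_mulA quat_mul1l quat_mul1r quat_mulDl quat_mulDr quat_oner_neq0.

Definition quat_scale (t : R) (q : H) : H :=
  Quat (t * qre q) (t * qi q) (t * qj q) (t * qk q).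

Lemma quat_scaleA s t q :
  quat_scale s (quat_scale t q) = quat_scale (s * t) q.
Proof. by congr Quat; rewrite /= mulrA. Qed.
Lemma quat_scale1 : left_id 1 quat_scale.
Proof. by case=> ? ? ? ?; congr Quat; rewrite /= mul1r. Qed.
Lemma quat_scaleDr : right_distributive quat_scale +%R.
Proof. by move=> ? [? ? ? ?] [? ? ? ?]; congr Quat; rewrite /= mulrDr. Qed.
Lemma quat_scaleDl q : {morph quat_scale^~ q : s t / s + t}.
Proof. by move=> ? ?; congr Quat; rewrite /= mulrDl. Qed.

HB.instance Definition _ := GRing.Zmodule_isLmodule.Build R H
  quat_scaleA quat_scale1 quat_scaleDr quat_scaleDl.

Lemma quat_scaleAl (t : R) (p q : H) : t *: (p * q) = (t *: p) * q.
Proof. by case: p q => ? ? ? ? [? ? ? ?]; congr Quat => /=; ring. Qed.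
Lemma quat_scaleAr (t : R) (p q : H) : t *: (p * q) = p * (t *: q).
Proof. by case: p q => ? ? ? ? [? ? ? ?]; congr Quat => /=; ring. Qed.

HB.instance Definition _ := GRing.Lmodule_isLalgebra.Build R H quat_scaleAl.
HB.instance Definition _ := GRing.Lalgebra_isAlgebra.Build R H quat_scaleAr.

Definition quat_sqnorm (q : H) : R :=
  qre q ^+ 2 + qi q ^+ 2 + qj q ^+ 2 + qk q ^+ 2.

Lemma quat_sqnorm_ge0 q : 0 <= quat_sqnorm q.
Proof. by rewrite /quat_sqnorm !addr_ge0 ?sqr_ge0. Qed.

Lemma quat_sqnorm_eq0 q : (quat_sqnorm q == 0) = (q == 0).
Proof.
apply/eqP/eqP => [|->]; last by rewrite /quat_sqnorm /= expr0n /= !addr0.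
case: q => a b c d; rewrite /quat_sqnorm /= => abcd0.
have := (sqr_ge0 a, sqr_ge0 b, sqr_ge0 c, sqr_ge0 d) => -[[[a0 b0] c0] d0].
by congr Quat; apply/eqP; rewrite -sqrf_eq0; apply/eqP; lra.
Qed.

Definition quat_conj (q : H) : H := Quat (qre q) (- qi q) (- qj q) (- qk q).

Definition quat_inv (q : H) : H := (quat_sqnorm q)^-1 *: quat_conj q.

Definition quat_unit : pred H := fun q => q != 0.

Lemma quat_mulVr : {in quat_unit, left_inverse 1 quat_inv *%R}.
Proof.
move=> [a b c d]; rewrite unfold_in -quat_sqnorm_eq0 => q0.
rewrite /quat_inv -quat_scaleAl.
rewrite (_ : quat_conj _ * _ = quat_sqnorm (Quat a b c d) *: 1).
  by rewrite scalerA mulVf // scale1r.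
by rewrite /quat_sqnorm /=; congr Quat => /=; ring.
Qed.

Lemma quat_mulrV : {in quat_unit, right_inverse 1 quat_inv *%R}.
Proof.
move=> [a b c d]; rewrite unfold_in -quat_sqnorm_eq0 => q0.
rewrite /quat_inv -quat_scaleAr.
rewrite (_ : _ * quat_conj _ = quat_sqnorm (Quat a b c d) *: 1).
  by rewrite scalerA mulVf // scale1r.
by rewrite /quat_sqnorm /=; congr Quat => /=; ring.
Qed.

Lemma quat_unitP p q : q * p = 1 /\ p * q = 1 -> quat_unit p.
Proof.
by move=> [qp _]; apply/eqP => p0; move: qp; rewrite p0 mulr0 => /esym/eqP;
  rewrite oner_eq0.
Qed.

Lemma quat_inv_out : {in [predC quat_unit], quat_inv =1 id}.
Proof.
move=> q; rewrite inE unfold_in negbK => /eqP ->.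
by rewrite /quat_inv; congr Quat; rewrite /= ?oppr0 mulr0.
Qed.

HB.instance Definition _ := GRing.NzRing_hasMulInverse.Build H
  quat_mulVr quat_mulrV quat_unitP quat_inv_out.

(* The norm [`|q|] is the Euclidean modulus; topology, uniformity and
   differentiability on [H] are the ones it induces. *)
Definition quat_norm (q : H) : R := Num.sqrt (quat_sqnorm q).

Lemma quat_normD p q : quat_norm (p + q) <= quat_norm p + quat_norm q.
Proof.
set dot := qre p * qre q + qi p * qi q + qj p * qj q + qk p * qk q.
have sqD : quat_sqnorm (p + q) = quat_sqnorm p + quat_sqnorm q + 2 * dot.
  by rewrite /dot /quat_sqnorm /=; ring.
have CS : dot ^+ 2 <= quat_sqnorm p * quat_sqnorm q.
  rewrite -subr_ge0 [leRHS](_ : _ = 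
      (qre p * qi q - qi p * qre q) ^+ 2 + (qre p * qj q - qj p * qre q) ^+ 2
    + (qre p * qk q - qk p * qre q) ^+ 2 + (qi p * qj q - qj p * qi q) ^+ 2
    + (qi p * qk q - qk p * qi q) ^+ 2 + (qj p * qk q - qk p * qj q) ^+ 2).
    by rewrite !addr_ge0 ?sqr_ge0.
  by rewrite /dot /quat_sqnorm /=; ring.
have dot_le : dot <= quat_norm p * quat_norm q.
  rewrite -sqrtrM ?quat_sqnorm_ge0 //; apply: le_trans (ler_norm _) _.
  by rewrite -sqrtr_sqr ler_wsqrtr.
rewrite -(@ler_pXn2r _ 2) // ?nnegrE ?addr_ge0 ?sqrtr_ge0 //.
rewrite sqrrD !sqr_sqrtr ?quat_sqnorm_ge0 // sqD.
by rewrite -mulr_natl; lra.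
Qed.

Lemma quat_normZ (t : R) q : quat_norm (t *: q) = `|t| * quat_norm q.
Proof.
rewrite /quat_norm -sqrtr_sqr -sqrtrM ?sqr_ge0 //; congr Num.sqrt.
by rewrite /quat_sqnorm /=; ring.
Qed.

Lemma quat_norm_eq0 q : quat_norm q = 0 -> q = 0.
Proof.
move=> /eqP; rewrite sqrtr_eq0 => q0; apply/eqP.
by rewrite -quat_sqnorm_eq0 eq_le q0 quat_sqnorm_ge0.
Qed.

HB.instance Definition _ :=
  Lmodule_isNormed.Build R H quat_normD quat_normZ quat_norm_eq0.

End QuaternionAlgebra.

Section Regular.
Variable R : realType.
Local Notation H := (quaternion R).

Definition imaginary_units : set H := [set q | q ^+ 2 = -1].

Definition domain (Omega : set H) :=
  [/\ open Omega, connected Omega & Omega !=set0].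

(* (1/2) (d/dx + I d/dy) f_I at x + I y *)
Definition cullen_dbar (f : H -> H) (I : H) (x y : R) : H :=
  2^-1 *: (derive1 (fun s : R => f (s%:A + I * y%:A)) x
           + I * derive1 (fun t : R => f (x%:A + I * t%:A)) y).

(* A function on [Omega] is a total function whose values outside [Omega] are
   irrelevant: [Omega] is open, so derivatives at its points only depend on the
   restriction to [Omega]. *)
Definition regular (Omega : set H) (f : H -> H) :=
  [/\ domain Omega,
      forall q, Omega q -> differentiable f q &
      forall I, imaginary_units I -> forall x y : R,
        Omega (x%:A + I * y%:A) -> cullen_dbar f I x y = 0].

End Regular.

Section Laurent.
Variable R : realType.
Local Notation H := (quaternion R).

Definition shell (R1 R2 : \bar R) : set H :=
  [set q | (R1 < `|q|%:E)%E /\ (`|q|%:E < R2)%E].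

Implicit Types (a : int -> H) (u : H -> H ^nat) (K Omega : set H).

Definition pos_term a (q : H) : H ^nat := fun n => q ^+ n * a n%:Z.
Definition neg_term a (q : H) : H ^nat := fun n => q ^- n * a (- n%:Z).

Definition pos_converges a (q : H) := cvgn (series (pos_term a q)).

(* [0^-1 = 0] in a [unitRingType], whereas [q ^- n * a (- n)] is meaningless at
   [q = 0] unless [a (- n) = 0] or [n = 0]; the first conjunct requires all terms
   to be meaningful. *)
Definition neg_converges a (q : H) :=
  (q = 0 -> forall n : nat, (0 < n)%N -> a (- n%:Z) = 0) /\
  cvgn (series (neg_term a q)).

Definition abs_unif_cvg_on_compacts u Omega :=
  forall K, compact K -> K `<=` Omega ->
    (forall q, K q -> cvgn [normed series (u q)]) /\
    {uniform K, (fun n q => series (u q) n) @ \oo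
                  --> (fun q => limn (series (u q)))}.

Definition convergence_radii a (R1 R2 : \bar R) :=
  [/\ (0 <= R1)%E /\ (0 <= R2)%E,
      abs_unif_cvg_on_compacts (pos_term a) (shell R1 R2),
      abs_unif_cvg_on_compacts (neg_term a) (shell R1 R2) &
      forall q, ~ closure (shell R1 R2) q -> ~ (shell R1 R2 = set0 /\ q = 0) ->
        ~ (pos_converges a q /\ neg_converges a q)].

Definition laurent_sum a (q : H) : H :=
  limn (series (pos_term a q)) + limn (series (fun n => neg_term a q n.+1)).

End Laurent.

(* Main.v *)
Require Import Defs.
From HB Require Import structures.
From mathcomp Require Import all_boot all_order all_algebra.
From mathcomp Require Import ring lra.
From mathcomp Require Import boolp classical_sets functions reals ereal.
From mathcomp Require Import topology normedtype landau sequences derive trigo.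

(** A quaternionic Laurent series splits as P(q) + Q(q^-1) for two power series
    P(w) = sum_n w^n b_n with coefficients on the right, so regularity reduces
    to three facts: P is real differentiable inside its disc of convergence, so
    is inversion away from 0, and both differentials are linear over the slice.

    Differentiability.  In the noncommutative algebra of quaternions,
    (w + h)^n = w^n + E_n(h) + rho_n(h), where E_n(h) sums the words in w and h
    with exactly one letter h.  Comparing with the expansion of (|w| + t)^n
    gives |E_n(h)| <= s^n |h| / t and |rho_n(h)| <= s^n |h|^2 / t^2 as soon as
    s exceeds |w| and |w + h| by at least t ([power_diff_norm],
    [power_remainder]).  Absolute convergence of sum_n s^n b_n at a single
    s > |w| thus bounds the sum of the remainders by C |h|^2, and the series can
    be differentiated term by term ([is_diff_series]).

    Regularity.  If h commutes with w, then E_n(h) = h E_n(1), so the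
    differential D of P at w satisfies D(h) = h D(1) for such h.  This property
    ([slice_differentiable]) passes to sums and survives composition with
    inversion, whose differential h |-> - q^-1 h q^-1 has it too.  On the slice
    of I, every q commutes with I, the partial derivatives are D(1) and
    D(I) = I D(1), and D(1) + I D(I) = (1 + I^2) D(1) = 0 ([cullen_dbar_eq0]).

    Absolute convergence at two real points r1 < |q| < r2 of the shell is what
    puts q^-1 and q inside the discs of convergence of Q and P.  The shell is
    connected since each of its points lies on a circle r (cos t + I sin t) that
    meets the connected set of real radii. *)

Set Implicit Arguments.
Unset Strict Implicit.
Unset Printing Implicit Defensive.

Import Order.TTheory GRing.Theory Num.Theory.
Import numFieldTopology.Exports numFieldNormedType.Exports.

Local Open Scope classical_set_scope.
Local Open Scope ring_scope.

(** * Differentiation from quadratic remainders *)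

Section Termwise.
Context {R : realType} {V : normedModType R}.

Lemma le_norm_linear_continuous (W : normedModType R) (L : {linear V -> W})
    (M : R) :
  (forall h, `|L h| <= M * `|h|) -> continuous L.
Proof.
move=> LM; apply: bounded_linear_continuous; apply/linear_boundedP.
near=> r; move=> h; apply: le_trans (LM h) _; apply: ler_wpM2r => //.
Unshelve. all: by end_near. Qed.

(** A quadratic remainder is a little-o of h; every differential below is
    obtained from such an estimate. *)
Lemma is_diff_quadratic (W : normedModType R) (f : V -> W)
    (L : {linear V -> W}) (x : V) (M C d : R) :
  0 < d -> (forall h, `|L h| <= M * `|h|) ->
  (forall h, `|h| <= d -> `|f (x + h) - f x - L h| <= C * `|h| ^+ 2) ->
  is_diff x f L.
Proof.
move=> d0 LM fC.
have Lc := le_norm_linear_continuous LM.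
have fL : f \o shift x = cst (f x) + L +o_ 0 id.
  apply/eqaddoP => _/posnumP[e]; near=> h.
  have hd : `|h| <= d by near: h; apply: nbhs0_le.
  (* adding 1 keeps the divisor positive when C = 0 *)
  have hC : (`|C| + 1) * `|h| <= e%:num.
    rewrite -ler_pdivlMl ?ltr_wpDl//; near: h; apply: nbhs0_le.
  rewrite [X in `|X|](_ : _ = f (x + h) - f x - L h); last first.
    by rewrite !fctE /= opprD addrA (addrC h).
  apply: le_trans (fC h hd) _; rewrite expr2 mulrA; apply: ler_wpM2r => //.
  apply: le_trans _ hC; apply: ler_wpM2r => //.
  by apply: le_trans (ler_norm C) _; rewrite lerDl.
by have dE := diff_unique Lc fL; split => //; apply/diff_locallyP; rewrite dE.
Unshelve. all: by end_near. Qed.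

Lemma normed_series_bound (W : completeNormedModType R) (u : W^nat)
    (v : R^nat) (k : R) :
  cvgn (series v) -> (forall n, `|u n| <= v n * k) ->
  cvgn (series u) /\ `|limn (series u)| <= limn (series v) * k.
Proof.
move=> vc uv; have vkc := is_cvg_seriesZ (k := k) vc.
have vkE n : (k *: v) n = v n * k by rewrite mulrC.
have uc : cvgn [normed series u].
  apply: series_le_cvg vkc => n //=; rewrite vkE //.
  exact: le_trans (uv n).
split; first exact: normed_cvg.
apply: le_trans (lim_series_norm uc) _.
rewrite mulrC -[leRHS](lim_seriesZ k vc); apply: lim_series_le => // n.
by rewrite vkE; exact: uv.
Qed.

(** The bounds M n and C n are summable, so that the sum of the differentials is
    bounded and the sum of the quadratic remainders is again quadratic. *)
Lemma is_diff_series (W : completeNormedModType R) (f : nat -> V -> W)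
    (L : nat -> {linear V -> W}) (x : V) (M C : nat -> R) (d : R) :
  0 < d -> (forall n h, `|L n h| <= M n * `|h|) ->
  (forall n h, `|h| <= d ->
     `|f n (x + h) - f n x - L n h| <= C n * `|h| ^+ 2) ->
  cvgn (series M) -> cvgn (series C) ->
  (forall h, `|h| <= d -> cvgn (series (f^~ (x + h)))) ->
  is_diff x (fun y => limn (series (f^~ y))) (fun h => limn (series (L^~ h))).
Proof.
move=> d_gt0 LM fC Mc Cc fc; pose dsum h := limn (series (L^~ h)).
have L_cvg h : series (L^~ h) @ \oo --> dsum h.
  by case: (normed_series_bound Mc (LM^~ h)).
have dsum_linear : linear dsum.
  move=> k h1 h2; apply: cvg_lim => //.
  rewrite (_ : L^~ _ = k *: L^~ h1 + L^~ h2); last first.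
    by apply/funext => n; rewrite linearP.
  by rewrite seriesD seriesZ; apply: cvgD => //; exact: cvgZl_tmp.
pose D : {linear V -> W} :=
  HB.pack dsum (GRing.isLinear.Build _ _ _ _ _ dsum_linear).
apply: (@is_diff_quadratic _ _ D x (limn (series M)) (limn (series C)) d) => //.
  by move=> h; case: (normed_series_bound Mc (LM^~ h)).
move=> h hd; rewrite -[D h]/(dsum h) /dsum.
have f0 : cvgn (series (f^~ x))
  by rewrite -[x]addr0; apply: fc; rewrite normr0 ltW.
have f1 := fc h hd.
rewrite -limB // -limB //; last exact: is_cvgB.
rewrite -!seriesN -!seriesD.
by case: (normed_series_bound Cc (fun n => fC n h hd)).
Qed.

End Termwise.

(** * The normed algebra of quaternions *)

Section Norm.
Variable R : realType.
Local Notation H := (quaternion R).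
Implicit Types p q h : H.

Lemma quat_normE q : `|q| = Num.sqrt (quat_sqnorm q).
Proof. by []. Qed.

Lemma quat_normM p q : `|p * q| = `|p| * `|q|.
Proof.
rewrite !quat_normE -sqrtrM ?quat_sqnorm_ge0 //; congr Num.sqrt.
by case: p q => ? ? ? ? [? ? ? ?]; rewrite /quat_sqnorm /=; ring.
Qed.

Lemma quat_norm1 : `|1 : H| = 1.
Proof.
by rewrite quat_normE /quat_sqnorm /= expr0n /= !addr0 expr1n sqrtr1.
Qed.

Lemma quat_normX q n : `|q ^+ n| = `|q| ^+ n.
Proof.
by elim: n => [|n IHn]; rewrite ?expr0 ?quat_norm1 // !exprS quat_normM IHn.
Qed.

Lemma quat_normV q : `|q^-1| = `|q|^-1.
Proof.
have [->|q0] := eqVneq q 0; first by rewrite invr0 normr0 invr0.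
have nq0 : `|q| != 0 by rewrite normr_eq0.
by apply: (mulfI nq0); rewrite -quat_normM mulrV // quat_norm1 mulfV.
Qed.

Lemma quat_mull_continuous p : continuous (fun q : H => p * q).
Proof.
have Lp : linear (fun q : H => p * q) by move=> k q r; rewrite mulrDr scalerAr.
pose L : {linear H -> H} :=
  HB.pack (fun q : H => p * q) (GRing.isLinear.Build _ _ _ _ _ Lp).
by apply: (@le_norm_linear_continuous _ _ _ L `|p|) => q; rewrite -quat_normM.
Qed.

Lemma quat_coord_le q :
  [/\ `|qre q| <= `|q|, `|qi q| <= `|q|, `|qj q| <= `|q| & `|qk q| <= `|q|].
Proof.
case: q => a b c d; rewrite !quat_normE /quat_sqnorm /=.
by split; rewrite -sqrtr_sqr ler_wsqrtr //;
  have := (sqr_ge0 a, sqr_ge0 b, sqr_ge0 c, sqr_ge0 d) => -[[[? ?] ?] ?]; lra.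
Qed.

Lemma quat_norm_le q : `|q| <= `|qre q| + `|qi q| + `|qj q| + `|qk q|.
Proof.
case: q => a b c d /=.
have -> : Quat a b c d = a *: Quat 1 0 0 0 + b *: Quat 0 1 0 0
                       + c *: Quat 0 0 1 0 + d *: Quat 0 0 0 1.
  by congr Quat; rewrite /= !(mulr0, mulr1, addr0, add0r).
have n1 (u : H) : quat_sqnorm u = 1 -> forall t, `|t *: u| <= `|t|.
  by move=> u1 t; rewrite normrZ quat_normE u1 sqrtr1 mulr1.
do !(apply: le_trans (ler_normD _ _) _; rewrite lerD //);
  by apply: n1; rewrite /quat_sqnorm /=; ring.
Qed.

(** The four coordinate maps are 1-Lipschitz, so they send a Cauchy filter to
    Cauchy filters of reals; the limits are the coordinates of its limit. *)
Lemma quat_complete (F : set_system H) : ProperFilter F -> cauchy F -> cvg F.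
Proof.
move=> FF /cauchy_ballP Fc.
have coord_cvg (g : H -> R) : {morph g : p q / p - q} ->
    (forall q, `|g q| <= `|q|) -> cvg (g @ F).
  move=> gB gle; apply: cauchy_cvg; apply/cauchy_ballP => e e0.
  rewrite near_map2; apply: filterS (Fc e e0) => -[p q].
  rewrite -!ball_normE /ball_ /= -gB; exact/le_lt_trans/gle.
have cvre : cvg (@qre R @ F).
  by apply: coord_cvg => // q; case: (quat_coord_le q).
have cvi : cvg (@qi R @ F).
  by apply: coord_cvg => // q; case: (quat_coord_le q).
have cvj : cvg (@qj R @ F).
  by apply: coord_cvg => // q; case: (quat_coord_le q).
have cvk : cvg (@qk R @ F).
  by apply: coord_cvg => // q; case: (quat_coord_le q).
apply/cvg_ex; exists (Quat (lim (@qre R @ F)) (lim (@qi R @ F))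
  (lim (@qj R @ F)) (lim (@qk R @ F))).
apply/cvgrPdist_le => e e0; have e4 : 0 < e / 4 by lra.
near=> q; apply: le_trans (quat_norm_le _) _ => /=.
have lre : `|lim (@qre R @ F) - qre q| <= e / 4.
  by near: q; move/cvgrPdist_le: cvre; apply.
have li : `|lim (@qi R @ F) - qi q| <= e / 4.
  by near: q; move/cvgrPdist_le: cvi; apply.
have lj : `|lim (@qj R @ F) - qj q| <= e / 4.
  by near: q; move/cvgrPdist_le: cvj; apply.
have lk : `|lim (@qk R @ F) - qk q| <= e / 4.
  by near: q; move/cvgrPdist_le: cvk; apply.
lra.
Unshelve. all: by end_near. Qed.

HB.instance Definition _ := Uniform_isComplete.Build H quat_complete.

End Norm.

(** * Power series *)

Section PowerSeries.
Variable R : realType.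
Local Notation H := (quaternion R).
Implicit Types (q h w : H) (b : nat -> H) (s t : R).

(** The sum of the w^i h w^(n-1-i) for i < n, that is the differential of
    w |-> w^n at w applied to h, written so that induction on n mirrors
    w^(n+1) = w^n w. *)
Fixpoint power_diff w n h : H :=
  if n is m.+1 then power_diff w m h * w + w ^+ m * h else 0.

Lemma power_diff_linear w n : linear (power_diff w n).
Proof.
elim: n => [|n IHn] k h1 h2 /=; first by rewrite scaler0 addr0.
by rewrite IHn scalerDr mulrDl mulrDr scalerAl scalerAr addrACA.
Qed.

Lemma power_diff_comm w n h :
  GRing.comm h w -> power_diff w n h = h * power_diff w n 1.
Proof.
move=> hw; elim: n => [|n IHn] /=; first by rewrite mulr0.
by rewrite IHn mulrDr mulrA mulr1 (commrX n hw).
Qed.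

(** The margin t absorbs the factor n of the usual bound n |w|^(n-1) |h|, as
    n |w|^(n-1) t is a single term of the expansion of (|w| + t)^n. *)
Lemma power_diff_norm w n h s t : 0 <= t -> `|w| + t <= s ->
  `|power_diff w n h| * t <= s ^+ n * `|h|.
Proof.
move=> t0 wts; elim: n => [|n IHn] /=.
  by rewrite normr0 mul0r mulr_ge0.
have s0 : 0 <= s by apply: le_trans wts; rewrite addr_ge0.
have ws : `|w| <= s by apply: le_trans wts; rewrite lerDl.
apply: le_trans (ler_wpM2r t0 (ler_normD _ _)) _.
rewrite !quat_normM quat_normX mulrDl.
have wn : `|w| ^+ n * `|h| * t <= s ^+ n * `|h| * t.
  by rewrite !ler_wpM2r // lerXn2r // nnegrE.
apply: le_trans (lerD _ wn) _.
  by rewrite mulrAC; apply: ler_wpM2r IHn.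
rewrite -mulrDr exprSr -mulrA [s * _]mulrC mulrA; apply: ler_wpM2l wts.
by rewrite mulr_ge0 // exprn_ge0.
Qed.

(** Multiplying by one more factor w + h turns the remainder rho_n into
    rho_(n+1) = rho_n (w + h) + E_n(h) h, so the margin t is used twice: once
    for the factor w + h and once through [power_diff_norm]. *)
Lemma power_remainder w n h s t : 0 <= t -> `|w| + t <= s ->
  `|w + h| + t <= s ->
  `|(w + h) ^+ n - w ^+ n - power_diff w n h| * t ^+ 2 <= s ^+ n * `|h| ^+ 2.
Proof.
move=> t0 wts whts; elim: n => [|n IHn] /=.
  by rewrite subrr subr0 normr0 mul0r mulr_ge0 // sqr_ge0.
have s0 : 0 <= s by apply: le_trans wts; rewrite addr_ge0.
set r := _ - _ - _ in IHn *.
rewrite [X in `|X|](_ : _ = r * (w + h) + power_diff w n h * h); last first.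
  rewrite /r !exprSr !mulrBl [w ^+ n * (w + h)]mulrDr.
  by rewrite [power_diff w n h * (w + h)]mulrDr !opprD !addrA subrK addrAC.
apply: le_trans (ler_wpM2r (sqr_ge0 t) (ler_normD _ _)) _.
rewrite !quat_normM mulrDl.
have rn : `|r| * `|w + h| * t ^+ 2 <= s ^+ n * `|h| ^+ 2 * `|w + h|.
  by rewrite mulrAC; apply: ler_wpM2r IHn.
have en : `|power_diff w n h| * `|h| * t ^+ 2 <= s ^+ n * `|h| ^+ 2 * t.
  rewrite [leLHS](_ : _ = `|power_diff w n h| * t * (`|h| * t)); last by ring.
  rewrite [leRHS](_ : _ = s ^+ n * `|h| * (`|h| * t)); last by ring.
  by apply: ler_wpM2r; [rewrite mulr_ge0 | exact: power_diff_norm].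
apply: le_trans (lerD rn en) _.
rewrite -mulrDr (exprSr s) [leRHS]mulrAC; apply: ler_wpM2l => //.
by rewrite mulr_ge0 ?exprn_ge0 ?sqr_ge0.
Qed.

Definition term_diff b w n h := power_diff w n h * b n.

Lemma term_diff_linear b w n : linear (term_diff b w n).
Proof.
by move=> k h1 h2; rewrite /term_diff power_diff_linear mulrDl scalerAl.
Qed.

HB.instance Definition _ b w n :=
  GRing.isLinear.Build R H H _ (term_diff b w n) (term_diff_linear b w n).

Definition power_series b w := limn (series (fun n => w ^+ n * b n)).

(** With t = (s - |w|) / 2, both |w| and |w + h| for |h| <= t stay below s
    by the margin t. *)
Lemma is_diff_power_series b w s :
    `|w| < s -> cvgn (series (fun n => s ^+ n * `|b n|)) ->
  is_diff w (power_series b)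
    (fun h => limn (series (term_diff b w ^~ h))).
Proof.
move=> ws sc; pose t := (s - `|w|) / 2.
have t0 : 0 < t by rewrite /t; lra.
have wts : `|w| + t <= s by rewrite /t; lra.
have s0 : 0 <= s by apply: le_trans (ltW ws).
have sum_scale k : cvgn (series (fun n => s ^+ n * `|b n| * k)).
  rewrite (_ : (fun n => _) = k *: (fun n => s ^+ n * `|b n|)).
    exact: is_cvg_seriesZ.
  by apply/funext => n; rewrite mulrC.
apply: (@is_diff_series _ _ _ (fun n w => w ^+ n * b n)
  (term_diff b w) w
  (fun n => s ^+ n * `|b n| * t^-1) (fun n => s ^+ n * `|b n| * (t ^+ 2)^-1) t).
- exact: t0.
- move=> n h; rewrite quat_normM.
  rewrite [leRHS](_ : _ = s ^+ n * `|h| / t * `|b n|); last by ring.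
  apply: ler_wpM2r => //; rewrite ler_pdivlMr //.
  by apply: power_diff_norm => //; exact: ltW.
- move=> n h ht; rewrite -!mulrBl quat_normM.
  rewrite [leRHS](_ : _ = s ^+ n * `|h| ^+ 2 / t ^+ 2 * `|b n|); last by ring.
  apply: ler_wpM2r => //; rewrite ler_pdivlMr ?exprn_gt0 //.
  apply: power_remainder => //; first exact: ltW.
  have := ler_normD w h; rewrite /t in ht *; lra.
- exact: sum_scale.
- exact: sum_scale.
move=> h ht; apply: normed_cvg; apply: series_le_cvg sc => n //=.
  by rewrite mulr_ge0 ?exprn_ge0.
rewrite quat_normM quat_normX; apply: ler_wpM2r => //.
apply: lerXn2r; rewrite ?nnegrE //.
have := ler_normD w h; rewrite /t in ht *; lra.
Qed.

End PowerSeries.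

(** * Differentials linear over slices *)

Section Slice.
Variable R : realType.
Local Notation H := (quaternion R).
Implicit Types (q h w : H) (b : nat -> H) (s t : R).

(** For a non-real q the quaternions commuting with q form the slice of q, so
    this says that the differential is linear over that complex line: the
    Cauchy-Riemann equation without coordinates. *)
Definition slice_differentiable (f : H -> H) q :=
  differentiable f q /\ forall h, GRing.comm h q -> 'd f q h = h * 'd f q 1.

Lemma slice_differentiableD (f g : H -> H) q :
  slice_differentiable f q -> slice_differentiable g q ->
  slice_differentiable (f \+ g) q.
Proof.
move=> [df fh] [dg gh]; split; first exact: differentiableD.
by move=> h hq; rewrite diffD //= fh // gh // mulrDr.
Qed.

(** Termwise, a letter h commuting with w can be pulled to the left of each word
    of [power_diff w n h], away from the coefficient on the right. *)
Lemma slice_differentiable_power_series b w s :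
    `|w| < s -> cvgn (series (fun n => s ^+ n * `|b n|)) ->
  slice_differentiable (power_series b) w.
Proof.
move=> ws sc; have [dP dE] := is_diff_power_series ws sc.
split=> // h hw; rewrite dE; apply: cvg_lim => //.
rewrite (_ : series _ = (fun q => h * q) \o series (term_diff b w ^~ 1)).
  apply: continuous_cvg; first exact: quat_mull_continuous.
  pose t := s - `|w|; have t0 : 0 < t by rewrite subr_gt0.
  apply: normed_cvg.
  apply: series_le_cvg (is_cvg_seriesZ (k := t^-1) sc) => n //=.
    rewrite mulr_ge0 ?invr_ge0 ?(ltW t0) ?mulr_ge0 ?exprn_ge0 //.
    exact: le_trans (ltW ws).
  rewrite quat_normM; rewrite [leRHS](_ : _ = s ^+ n * `|1 : H| / t * `|b n|).
    rewrite ler_wpM2r // ler_pdivlMr //; apply: power_diff_norm.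
      exact: ltW.
    by rewrite /t addrC subrK.
  rewrite quat_norm1 mulr1 [LHS](_ : _ = t^-1 * (s ^+ n * `|b n|)) //.
  by ring.
apply/funext => n; rewrite /series /= mulr_sumr; apply: eq_bigr => k _.
by rewrite /term_diff power_diff_comm // mulrA.
Qed.

Definition inv_diff q h : H := - (q^-1 * h * q^-1).

Lemma inv_diff_linear q : linear (inv_diff q).
Proof.
move=> k h1 h2; rewrite /inv_diff mulrDr mulrDl opprD.
by rewrite -(scalerAr k q^-1) -(scalerAl k (q^-1 * h1)) scalerN.
Qed.

HB.instance Definition _ q :=
  GRing.isLinear.Build R H H _ (inv_diff q) (inv_diff_linear q).

(** The remainder is exactly (q + h)^-1 h q^-1 h q^-1, and |q + h| >= |q| / 2 as
    soon as |h| <= |q| / 2. *)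
Lemma is_diff_quat_inv q : q != 0 -> is_diff q (fun p : H => p^-1) (inv_diff q).
Proof.
move=> q0; have nq0 : 0 < `|q| by rewrite normr_gt0.
apply: (@is_diff_quadratic _ _ _ _ (inv_diff q) q
   (`|q|^-1 ^+ 2) (2 * `|q|^-1 ^+ 3) (`|q| / 2)) => [|h|h hq]; first by lra.
  rewrite /inv_diff normrN !quat_normM quat_normV.
  by rewrite [leLHS](_ : _ = `|q|^-1 ^+ 2 * `|h|) //; ring.
have qh2 : `|q| / 2 <= `|q + h|.
  have := ler_normD (q + h) (- h); rewrite addrK normrN; lra.
have qh0 : q + h != 0 by rewrite -normr_gt0; apply: lt_le_trans qh2; lra.
rewrite [X in `|X|](_ : _ = (q + h)^-1 * h * q^-1 * h * q^-1); last first.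
  have inv_sub : (q + h)^-1 - q^-1 = - ((q + h)^-1 * h * q^-1).
    apply: (mulIr (q0 : q \is a GRing.unit)).
    apply: (mulrI (qh0 : q + h \is a GRing.unit)).
    rewrite mulrBl mulVr // mulrBr mulr1 mulrA mulrV // mul1r.
    rewrite mulNr mulrVK // mulrN mulrA mulrV // mul1r.
    by rewrite opprD addrA subrr add0r.
  rewrite /inv_diff opprK {1}inv_sub addrC -!mulrBl.
  by rewrite -[q^-1 - _]opprB inv_sub opprK.
rewrite !quat_normM !quat_normV.
have ih : `|q + h|^-1 <= 2 * `|q|^-1.
  by rewrite -[2]invrK -invfM lef_pV2 ?posrE ?normr_gt0 // mulrC //; lra.
rewrite [leLHS](_ : _ = `|q + h|^-1 * (`|h| ^+ 2 * `|q|^-1 ^+ 2)); last by ring.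
rewrite [leRHS](_ : _ = 2 * `|q|^-1 * (`|h| ^+ 2 * `|q|^-1 ^+ 2)); last by ring.
by apply: ler_wpM2r => //; rewrite mulr_ge0 ?sqr_ge0.
Qed.

(** If h commutes with q, then - q^-1 h q^-1 = h (- q^-2) commutes with q^-1, so
    the slice property of f at q^-1 applies to it. *)
Lemma slice_differentiable_comp_inv (f : H -> H) q : q != 0 ->
  slice_differentiable f q^-1 -> slice_differentiable (fun p => f p^-1) q.
Proof.
move=> q0 [df fh]; have [di iE] := is_diff_quat_inv q0.
split; first exact: (differentiable_comp di df).
move=> h hq; rewrite (diff_comp di df) /= iE /inv_diff.
have hV : GRing.comm h q^-1 by apply: commrV.
have cV : GRing.comm (- (q^-1 * q^-1)) q^-1.
  by apply/commr_sym/commrN/commrM; apply: commr_refl.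
rewrite mulr1 -hV -[h / q / q]mulrA -mulrN fh; last first.
  by apply/commr_sym/commrM; apply/commr_sym.
by rewrite [in RHS](fh _ cV) mulrA.
Qed.

Lemma cullen_dbar_eq0 (f : H -> H) (I : H) (x y : R) : imaginary_units I ->
  slice_differentiable f (x%:A + I * y%:A) -> cullen_dbar f I x y = 0.
Proof.
move=> I2 [df fh]; rewrite /cullen_dbar; set q := _ + _ in df fh *.
(* the partial derivatives are directional derivatives along 1 and I *)
have Dx : derive1 (fun s : R => f (s%:A + I * y%:A)) x = 'd f q 1.
  rewrite -deriveE // /derive1 /derive.
  apply: (congr1 (fun g : R -> H => lim (g @ 0^'))).
  by apply/funext => k; rewrite /= scalerDl addrA.
have Dy : derive1 (fun s : R => f (x%:A + I * s%:A)) y = 'd f q I.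
  rewrite -deriveE // /derive1 /derive.
  apply: (congr1 (fun g : R -> H => lim (g @ 0^'))).
  by apply/funext => k; rewrite /= scalerDl mulrDr -(scalerAr k I) mulr1 addrCA.
have Iq : GRing.comm I q.
  have scal_comm (k : R) : GRing.comm I k%:A.
    by rewrite /GRing.comm -(scalerAr k I) -(scalerAl k 1) mulr1 mul1r.
  by apply: commrD => //; apply: commrM.
rewrite Dx Dy (fh I Iq) mulrA -expr2.
by move: I2 => /= ->; rewrite mulN1r subrr scaler0.
Qed.

End Slice.

(** * Topology of shells *)

Section Shell.
Variable R : realType.
Local Notation H := (quaternion R).
Implicit Types (q : H) (r : R).

Lemma ereal_dense_fin (R1 R2 : \bar R) : (R1 < R2)%E ->
  exists r, (R1 < r%:E)%E /\ (r%:E < R2)%E.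
Proof.
case: R1 R2 => [r1| |] [r2| |] //= lt12.
- by move: lt12; rewrite lte_fin => lt12; exists ((r1 + r2) / 2);
    rewrite !lte_fin; split; lra.
- by exists (r1 + 1); rewrite lte_fin ltry; split => //; lra.
- by exists (r2 - 1); rewrite lte_fin ltNyr; split => //; lra.
- by exists 0; rewrite ltry ltNyr.
Qed.

Definition radii (R1 R2 : \bar R) : set R :=
  [set r | (R1 < r%:E)%E /\ (r%:E < R2)%E].

Lemma open_shell R1 R2 : open (shell R1 R2 : set H).
Proof.
rewrite (_ : shell R1 R2 = Num.norm @^-1` radii R1 R2) //.
apply: open_comp; first by move=> q _; exact: norm_continuous.
by apply: openI; [exact: open_ereal_gt | exact: open_ereal_lt].
Qed.

Lemma norm_real r : `|r%:A : H| = `|r|.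
Proof. by rewrite normrZ quat_norm1 mulr1. Qed.

Lemma shell_nonempty R1 R2 : (0 <= R1)%E -> (R1 < R2)%E ->
  (shell R1 R2 : set H) !=set0.
Proof.
move=> R1_ge0 /ereal_dense_fin[r [r1 r2]]; exists (r%:A).
rewrite /shell /= norm_real ger0_norm // ltW //.
by rewrite -lte_fin (le_lt_trans R1_ge0).
Qed.

Lemma connected_radii R1 R2 : connected (radii R1 R2).
Proof.
apply/connected_intervalP => r s [r1 _] [_ s2] t /andP[rt ts]; split.
  by apply: lt_le_trans r1 _; rewrite lee_fin.
by apply: le_lt_trans s2; rewrite lee_fin.
Qed.

(** For v purely imaginary of norm r, this is the circle r (cos t + I sin t)
    with I = v / r; scaling by v also covers the degenerate case r = 0. *)
Definition circle (v : H) r (t : R) : H := (r * cos t)%:A + sin t *: v.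

Lemma circle_continuous v r : continuous (circle v r).
Proof.
move=> t; apply: cvgD; apply: cvgZr_tmp; last exact: (@continuous_sin R).
by apply: cvgM; [exact: cvg_cst | exact: (@continuous_cos R)].
Qed.

Lemma norm_circle v r t : qre v = 0 -> `|v| = r -> `|circle v r t| = r.
Proof.
move=> v0 vr; rewrite quat_normE (_ : quat_sqnorm _ = quat_sqnorm v).
  by rewrite -quat_normE.
have vr2 : quat_sqnorm v = r ^+ 2.
  by rewrite -vr quat_normE sqr_sqrtr // quat_sqnorm_ge0.
have s2 : sin t ^+ 2 = 1 - cos t ^+ 2 by rewrite -(cos2Dsin2 t); ring.
transitivity (r ^+ 2 * cos t ^+ 2 + sin t ^+ 2 * quat_sqnorm v).
  by rewrite /quat_sqnorm /= v0; ring.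
by rewrite vr2 s2; ring.
Qed.

(** With q = x + y I and y >= 0 the norm of the imaginary part, the angle is
    acos (x / |q|), whose sine is y / |q|. *)
Lemma circleP q : exists v,
  [/\ qre v = 0, `|v| = `|q| & exists t, circle v `|q| t = q].
Proof.
pose im : H := Quat 0 (qi q) (qj q) (qk q).
have qE : q = (qre q)%:A + im.
  case: q @im => a b c d /=.
  by congr Quat; rewrite /= ?mulr1 ?mulr0 ?addr0 ?add0r.
have [u [u0 u1 imE]] : exists u : H, [/\ qre u = 0, `|u| = 1 & im = `|im| *: u].
  have [->|im0] := eqVneq im 0.
    (* a real q lies on every slice *)
    exists (Quat 0 1 0 0); split => //; last by rewrite normr0 scale0r.
    by rewrite quat_normE /quat_sqnorm /= !expr0n expr1n /= add0r !addr0 sqrtr1.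
  exists (`|im|^-1 *: im); rewrite /= mulr0; split => //.
    by rewrite normrZ normfV normr_id mulVf // normr_eq0.
  by rewrite scalerA mulfV ?scale1r // normr_eq0.
exists (`|q| *: u); rewrite /= u0 mulr0 normrZ normr_id u1 mulr1; split => //.
have [->|q0] := eqVneq q 0.
  by exists 0; rewrite /circle normr0 mul0r !scale0r scaler0 addr0.
have nq0 : 0 < `|q| by rewrite normr_gt0.
have sqE : `|q| ^+ 2 = qre q ^+ 2 + `|im| ^+ 2.
  rewrite !quat_normE !sqr_sqrtr ?quat_sqnorm_ge0 //.
  by rewrite /quat_sqnorm /=; ring.
have re1 : -1 <= qre q / `|q| <= 1.
  rewrite -ler_norml normrM normfV normr_id ler_pdivrMr // mul1r.
  by case: (quat_coord_le q).
exists (acos (qre q / `|q|)).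
rewrite /circle acosK ?in_itv // sin_acos //.
rewrite (_ : 1 - _ = (`|im| / `|q|) ^+ 2); last first.
  rewrite !expr_div_n -[X in X - _](@divff _ (`|q| ^+ 2)) ?sqrf_eq0 ?gt_eqF //.
  by rewrite -mulrBl sqE addrAC subrr add0r.
rewrite sqrtr_sqr ger0_norm ?divr_ge0 // scalerA mulrC.
rewrite !mulrVK ?unitfE ?gt_eqF //.
by rewrite -imE -qE.
Qed.

(** Each circle crosses the ray of real radii at its parameter 0, so the shell
    is a union of connected sets that all contain this ray. *)
Lemma connected_shell R1 R2 : (0 <= R1)%E -> (R1 < R2)%E ->
  connected (shell R1 R2 : set H).
Proof.
move=> R1_ge0 R12; have [r0 r0s] := ereal_dense_fin R12.
have radii_norm r : radii R1 R2 r -> `|r| = r.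
  by move=> [r1 _]; rewrite ger0_norm // ltW // -lte_fin (le_lt_trans R1_ge0).
pose ray : set H := (fun r => r%:A) @` radii R1 R2.
have ray_conn : connected ray.
  apply: connected_continuous_connected; first exact: connected_radii.
  by apply: continuous_subspaceT => r; apply: cvgZr_tmp.
have ray_sub : ray `<=` shell R1 R2.
  by move=> _ [r rs <-]; rewrite /shell /= norm_real (radii_norm _ rs).
pose P := [set vr : H * R |
  [/\ radii R1 R2 vr.2, qre vr.1 = 0 & `|vr.1| = vr.2]].
pose A (vr : H * R) : set H := ray `|` range (circle vr.1 vr.2).
have -> : shell R1 R2 = \bigcup_(vr in P) A vr.
  apply/seteqP; split=> [q qs|q [[v r] [/= rs v0 vr] [|[t _ <-]]]].
  - have [v [v0 vq [t vtq]]] := circleP q.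
    by exists (v, `|q|); [split | right; exists t].
  - exact: ray_sub.
  - by rewrite /shell /= norm_circle.
apply: bigcup_connected => [|[v r] [/= rs v0 vr]].
  by exists (r0%:A) => vr _; left; exists r0.
apply: connectedU => //.
  exists (r%:A); split; first by exists r.
  by exists 0 => //; rewrite /circle /= cos0 sin0 mulr1 scale0r addr0.
apply: connected_continuous_connected; last first.
  exact/continuous_subspaceT/circle_continuous.
by apply/connected_intervalP.
Qed.

End Shell.

(** * Laurent series *)

Section Laurent.
Variable R : realType.
Local Notation H := (quaternion R).
Implicit Types (a : int -> H) (q : H).

(** The coefficient at 0 vanishes because a 0 already belongs to the series of
    nonnegative powers. *)
Definition principal_coef a (n : nat) : H :=
  if n is m.+1 then a (- n%:Z) else 0.

Lemma laurent_sumE a :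
  laurent_sum a = power_series (fun n => a n%:Z) \+
    (fun q => power_series (principal_coef a) q^-1).
Proof.
apply/funext => q; rewrite /laurent_sum /power_series /=; congr (_ + _).
pose u n := q^-1 ^+ n * principal_coef a n.
(* dropping the first partial sum does not change the limit *)
rewrite [RHS](_ : _ = limn (fun n => series u n.+1)); last first.
  congr (get _); apply/funext => l.
  by rewrite -[in LHS](cvg_shiftS (series _)).
congr (limn _); apply/funext => n; rewrite /series /= big_nat_recl //.
by rewrite /u mulr0 add0r; apply: eq_bigr => k _; rewrite /neg_term exprVn.
Qed.

(** A single point is a compact set. *)
Lemma abs_cvg_at (u : H -> H^nat) (Omega : set H) q :
  abs_unif_cvg_on_compacts u Omega -> Omega q -> cvgn [normed series (u q)].
Proof.
move=> uO Oq; have qO : [set q] `<=` Omega by move=> _ ->.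
by have [+ _] := uO _ (@compact_set1 _ q) qO; exact.
Qed.

(** Absolute convergence at r2 controls the nonnegative powers on the disc
    |q| < r2, and at r1 it controls the powers of q^-1 on |q^-1| < 1 / r1. *)
Lemma slice_differentiable_laurent_sum a (r1 r2 : R) q :
  0 < r1 < `|q| -> `|q| < r2 ->
  cvgn [normed series (neg_term a r1%:A)] ->
  cvgn [normed series (pos_term a r2%:A)] ->
  slice_differentiable (laurent_sum a) q.
Proof.
move=> /andP[r1_gt0 r1q] qr2 neg_cvg pos_cvg; rewrite laurent_sumE.
have q_gt0 := lt_trans r1_gt0 r1q.
have q0 : q != 0 by rewrite -normr_gt0.
have r2_gt0 := lt_trans q_gt0 qr2.
apply: slice_differentiableD.
  apply: slice_differentiable_power_series qr2 _.
  rewrite (_ : (fun n => _) = (fun n => `|pos_term a r2%:A n|)) //.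
  by apply/funext => n; rewrite quat_normM quat_normX norm_real gtr0_norm.
apply: slice_differentiable_comp_inv => //.
apply: (@slice_differentiable_power_series _ _ _ r1^-1).
  by rewrite quat_normV ltf_pV2 ?posrE.
apply: series_le_cvg neg_cvg => n //=.
  by rewrite mulr_ge0 // exprn_ge0 // invr_ge0 ltW.
rewrite quat_normM quat_normV quat_normX norm_real gtr0_norm // exprVn.
case: n => [|n] //=.
by rewrite normr0 mulr0 mulr_ge0 // invr_ge0 exprn_ge0 // ltW.
Qed.

End Laurent.

Theorem theorem3p2 (R : realType) (a : int -> quaternion R) (R1 R2 : \bar R)
    (conv : convergence_radii a R1 R2) (R1_lt_R2 : (R1 < R2)%E) :
  regular (shell R1 R2) (laurent_sum a).
Proof.
case: conv => -[R1_ge0 _] pos_cvg neg_cvg _.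
have slice q : shell R1 R2 q -> slice_differentiable (laurent_sum a) q.
  move=> [R1q qR2].
  have [r1 [R1r1 r1q]] := ereal_dense_fin R1q.
  have [r2 [qr2 r2R2]] := ereal_dense_fin qR2.
  have r1_gt0 : 0 < r1 by rewrite -lte_fin (le_lt_trans R1_ge0).
  have r2_gt0 : 0 < r2 by move: qr2; rewrite lte_fin; exact: le_lt_trans.
  apply: (@slice_differentiable_laurent_sum _ _ r1 r2).
  - by rewrite r1_gt0 /= -lte_fin.
  - by rewrite -lte_fin.
  - apply: abs_cvg_at neg_cvg _; rewrite /shell /= norm_real gtr0_norm //.
    by split => //; apply: lt_trans r1q qR2.
  - apply: abs_cvg_at pos_cvg _; rewrite /shell /= norm_real gtr0_norm //.
    by split => //; apply: lt_trans R1q qr2.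
split.
- split; [exact: open_shell | exact: connected_shell | exact: shell_nonempty].
- by move=> q /slice[].
- by move=> I I2 x y /slice; exact: cullen_dbar_eq0.
Qed.
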